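(* For all $X,Y,Z,W\in\Gamma(D)$, \begin{align*} \widetilde{R}(X,Y,Z,W)&=\widetilde{R}^D(X,Y,Z,W)-g(B(X,W),B(Y,Z))+g(B(Y,W),B(X,Z))\\ &\quad+g(Y,Z)\,\omega(B(X,W))-g(X,Z)\,\omega(B(Y,W))+g(X,W)\,\omega(B(Y,Z))\\ &\quad-g(Y,W)\,\omega(B(X,Z))-g(Y,Z)g(X,W)\,\omega(U^{D^\bot})\\ &\quad+g(X,Z)g(Y,W)\,\omega(U^{D^\bot})+g(B(Z,W),[X,Y]). \end{align*}
   Context: $(M,g)$ is a smooth Riemannian manifold with Levi-Civita connection $\nabla$. $D\subseteq TM$ is a smooth subbundle (distribution) of constant rank $n$ that is non integrable, i.e. there are $X,Y\in\Gamma(D)$ with $[X,Y]\notin\Gamma(D)$. $D^\bot$ is its orthogonal complement, $\pi^D:TM\to D$ and $\pi^{D^\bot}:TM\to D^\bot$ are the orthogonal projections, $[X,Y]^D=\pi^D[X,Y]$, $[X,Y]^{D^\bot}=\pi^{D^\bot}[X,Y]$. For $X,Y\in\Gamma(D)$, $B(X,Y)=\pi^{D^\bot}(\nabla_XY)$ (not symmetric in general). $U$ is a vector field on $M$, $\omega(V)=g(U,V)$, $U^{D^\bot}=\pi^{D^\bot}U$. The semi-symmetric metric connection on $M$ is $\widetilde\nabla_XY=\nabla_XY+\omega(Y)X-g(X,Y)U$. For $X,Y\in\Gamma(D)$ put $\widetilde\nabla^D_XY=\pi^D(\widetilde\nabla_XY)$. Curvatures: $\widetilde R(X,Y)Z=\widetilde\nabla_X\widetilde\nabla_YZ-\widetilde\nabla_Y\widetilde\nabla_XZ-\widetilde\nabla_{[X,Y]}Z$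 for vector fields on $M$, and for $X,Y,Z\in\Gamma(D)$ $$\widetilde R^D(X,Y)Z=\widetilde\nabla^D_X\widetilde\nabla^D_YZ-\widetilde\nabla^D_Y\widetilde\nabla^D_XZ-\widetilde\nabla^D_{[X,Y]^D}Z-\pi^D[[X,Y]^{D^\bot},Z].$$ Also $\widetilde R(X,Y,Z,W)=g(\widetilde R(X,Y)Z,W)$ and $\widetilde R^D(X,Y,Z,W)=g(\widetilde R^D(X,Y)Z,W)$. *)

(* Defs.v *)
From HB Require Import structures.
From mathcomp Require Import all_boot all_order all_algebra.
From mathcomp Require Import all_classical all_reals all_analysis.
From mathcomp Require Import ring.

Set Implicit Arguments.
Unset Strict Implicit.
Unset Printing Implicit Defensive.

Import Order.TTheory GRing.Theory Num.Theory.
Import numFieldNormedType.Exports.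

Local Open Scope classical_set_scope.
Local Open Scope ring_scope.

Section SmoothMaps.
Variables (R : realType) (m : nat).
Implicit Type W : normedModType R.

(* Only meant for open [A]: continuity and derivability at the points of [A]
   then depend only on the restriction of [f] to [A]. *)
Fixpoint Ck_on W (k : nat) (A : set 'rV[R]_m) (f : 'rV[R]_m -> W) : Prop :=
  (forall x, A x -> {for x, continuous f}) /\
  if k is k'.+1 then
    forall i : 'I_m, (forall x, A x -> derivable f x (delta_mx 0 i)) /\
                     Ck_on k' A (fun x => 'D_(delta_mx 0 i) f x)
  else True.

Definition smooth_on W (A : set 'rV[R]_m) (f : 'rV[R]_m -> W) : Prop :=
  forall k, Ck_on k A f.

Lemma open_eq_near W (A : set 'rV[R]_m) (f g : 'rV[R]_m -> W) x :
  open A -> (forall y, A y -> f y = g y) -> A x -> \forall y \near x, f y = g y.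
Proof. by move=> oA fg Ax; apply: filterS fg _; exact: open_nbhs_nbhs. Qed.

Lemma open_eq_continuous W (A : set 'rV[R]_m) (f g : 'rV[R]_m -> W) x :
  open A -> (forall y, A y -> f y = g y) -> A x ->
  {for x, continuous f} -> {for x, continuous g}.
Proof.
move=> oA fg Ax cf; rewrite /prop_for /continuous_at -fg//.
apply: cvg_trans cf; apply: (@near_eq_cvg _ _ (nbhs x) (nbhs_filter x)).
exact: open_eq_near oA fg Ax.
Qed.

Lemma Ck_on_eq W k (A : set 'rV[R]_m) (f g : 'rV[R]_m -> W) :
  open A -> (forall x, A x -> f x = g x) -> Ck_on k A f -> Ck_on k A g.
Proof.
move=> oA; elim: k f g => [|k IH] f g fg [cf df]; split=> //;
  try by move=> x Ax; exact: open_eq_continuous oA fg Ax (cf x Ax).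
move=> i; have [dfi ci] := df i; split=> [x Ax|].
  exact: near_eq_derivable (open_eq_near oA fg Ax) (dfi x Ax).
apply: IH ci => x Ax; apply: near_eq_derive; exact: open_eq_near oA fg Ax.
Qed.

Lemma Ck_onS W k (A : set 'rV[R]_m) (f : 'rV[R]_m -> W) :
  Ck_on k.+1 A f -> Ck_on k A f.
Proof.
elim: k f => [|k IH] f [cf df]; split=> // i.
by have [dfi ci] := df i; split=> //; exact: IH.
Qed.

Lemma Ck_on_cst W k (A : set 'rV[R]_m) (c : W) : Ck_on k A (fun=> c).
Proof.
elim: k c => [|k IH] c; split=> //; try by move=> x _; exact: cst_continuous.
move=> i; split=> [x _|]; first exact: derivable_cst.
have -> : (fun x : 'rV[R]_m => 'D_(delta_mx 0 i) (fun=> c) x) = fun=> (0 : W).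
  by apply/funext => x; exact: derive_cst.
exact: IH.
Qed.

Lemma Ck_onD W k (A : set 'rV[R]_m) (f g : 'rV[R]_m -> W) : open A ->
  Ck_on k A f -> Ck_on k A g -> Ck_on k A (f \+ g).
Proof.
move=> oA; elim: k f g => [|k IH] f g [cf df] [cg dg]; split=> //;
  try by move=> x Ax; exact: continuousD (cf x Ax) (cg x Ax).
move=> i; have [dfi ci] := df i; have [dgi di] := dg i.
split=> [x Ax|]; first exact: derivableD (dfi x Ax) (dgi x Ax).
apply: (Ck_on_eq oA _ (IH _ _ ci di)) => x Ax.
by rewrite /= deriveD//; [exact: dfi|exact: dgi].
Qed.

Lemma Ck_onM k (A : set 'rV[R]_m) (f g : 'rV[R]_m -> R) : open A ->
  Ck_on k A f -> Ck_on k A g -> Ck_on k A (f \* g).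
Proof.
move=> oA; elim: k f g => [|k IH] f g Cf Cg; case: (Cf) (Cg) => [cf df] [cg dg];
  split=> //; try by move=> x Ax; exact: continuousM (cf x Ax) (cg x Ax).
move=> i; have [dfi ci] := df i; have [dgi di] := dg i.
split=> [x Ax|]; first exact: derivableM (dfi x Ax) (dgi x Ax).
have := Ck_onD oA (IH _ _ (Ck_onS Cf) di) (IH _ _ (Ck_onS Cg) ci).
apply: (Ck_on_eq oA) => x Ax.
by rewrite [RHS]deriveM//; [exact: dfi|exact: dgi].
Qed.

End SmoothMaps.

(* [chart_inv] is a total function whose values outside [chart_cod] are
   irrelevant. *)
Record chart (R : realType) (m : nat) (M : topologicalType) := Chart {
  chart_dom : set M;
  chart_cod : set 'rV[R]_m;
  chart_map : M -> 'rV[R]_m;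
  chart_inv : 'rV[R]_m -> M;
  chart_dom_open : open chart_dom;
  chart_cod_open : open chart_cod;
  chart_mapP : forall p, chart_dom p -> chart_cod (chart_map p);
  chart_invP : forall x, chart_cod x -> chart_dom (chart_inv x);
  chart_mapK : forall p, chart_dom p -> chart_inv (chart_map p) = p;
  chart_invK : forall x, chart_cod x -> chart_map (chart_inv x) = x;
  chart_map_continuous : forall p, chart_dom p -> {for p, continuous chart_map};
  chart_inv_continuous : forall x, chart_cod x -> {for x, continuous chart_inv}
}.

(* Second countable Hausdorff manifolds without boundary, of dimension [m].
   The atlas need not be maximal: any atlas determines the smooth structure. *)
Record smoothManifold (R : realType) (m : nat) := SmoothManifold {
  manifold_sort :> topologicalType;
  manifold_hausdorff : hausdorff_space manifold_sort;
  manifold_second_countable : @second_countable manifold_sort;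
  atlas : set (chart R m manifold_sort);
  atlas_cover : forall p, exists2 c, atlas c & chart_dom c p;
  atlas_compat : forall c c', atlas c -> atlas c' ->
    smooth_on (chart_cod c `&` chart_inv c @^-1` chart_dom c')
              (chart_map c' \o chart_inv c)
}.

Section SmoothFunctions.
Variables (R : realType) (m : nat) (M : smoothManifold R m).

Definition smooth_fun_on (V : set M) (f : M -> R) : Prop :=
  forall c, atlas c ->
    smooth_on (chart_cod c `&` chart_inv c @^-1` V) (f \o chart_inv c).

Definition smooth_fun (f : M -> R) : Prop := smooth_fun_on setT f.

Definition smooth_pred : {pred M -> R} := [pred f | `[< smooth_fun f >]].

Lemma smooth_predP f : reflect (smooth_fun f) (f \in smooth_pred).
Proof. exact: asboolP. Qed.

Let cod_openT (c : chart R m M) :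
  open (chart_cod c `&` chart_inv c @^-1` setT).
Proof. by rewrite preimage_setT setIT; exact: chart_cod_open. Qed.

Lemma smooth_fun_cst (a : R) : smooth_fun (fun=> a).
Proof. by move=> c _ k; exact: Ck_on_cst. Qed.

Lemma smooth_funD f g : smooth_fun f -> smooth_fun g -> smooth_fun (f \+ g).
Proof.
move=> sf sg c ac k.
exact: (Ck_onD (@cod_openT c) (sf c ac k) (sg c ac k)).
Qed.

Lemma smooth_funM f g : smooth_fun f -> smooth_fun g -> smooth_fun (f \* g).
Proof.
move=> sf sg c ac k.
exact: (Ck_onM (@cod_openT c) (sf c ac k) (sg c ac k)).
Qed.

Lemma smooth_funZ a f : smooth_fun f -> smooth_fun (fun p => a * f p).
Proof. by move=> sf; exact: smooth_funM (smooth_fun_cst a) sf. Qed.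

Lemma smooth_funB f g : smooth_fun f -> smooth_fun g ->
  smooth_fun (fun p => f p - g p).
Proof.
move=> sf /(smooth_funZ (-1)) sg.
have -> : (fun p => f p - g p) = f \+ (fun p => -1 * g p).
  by apply/funext => p /=; rewrite mulN1r.
exact: smooth_funD.
Qed.

Lemma smooth_subring_closed : subring_closed smooth_pred.
Proof.
split=> [|f g /smooth_predP sf /smooth_predP sg
         |f g /smooth_predP sf /smooth_predP sg];
  apply/smooth_predP.
- exact: smooth_fun_cst.
- exact: smooth_funB.
- exact: smooth_funM.
Qed.

HB.instance Definition _ :=
  GRing.isSubringClosed.Build (M -> R) smooth_pred smooth_subring_closed.

Lemma smooth_scaler_closed : GRing.scaler_closed smooth_pred.
Proof. by move=> a f /smooth_predP sf; apply/smooth_predP; exact: smooth_funZ. Qed.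

HB.instance Definition _ :=
  GRing.isScaleClosed.Build R (M -> R) smooth_pred smooth_scaler_closed.

Record Cinf := MkCinf { Cinf_val :> M -> R; _ : Cinf_val \in smooth_pred }.

HB.instance Definition _ := [isSub for Cinf_val].
HB.instance Definition _ := [Choice of Cinf by <:].
HB.instance Definition _ := 
  GRing.SubChoice_isSubComPzRing.Build _ _ Cinf (subringClosedP _).
HB.instance Definition _ := [SubZmodule_isSubLmodule of Cinf by <:].

Lemma Cinf_smooth (f : Cinf) : smooth_fun f.
Proof. exact/smooth_predP/(valP f). Qed.

Definition cinf (f : M -> R) (sf : smooth_fun f) : Cinf :=
  MkCinf (introT (smooth_predP f) sf).

End SmoothFunctions.

Section TangentSpaces.
Variables (R : realType) (m : nat) (M : smoothManifold R m).

(* Tangent vectors at [p] are the derivations at [p] of the algebra of smooth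
   functions on [M]. *)
Definition derivation_at (p : M) (v : Cinf M -> R) : Prop :=
  (forall (a : R) (f h : Cinf M), v (a *: f + h) = a * v f + v h) /\
  (forall f h : Cinf M, v (f * h) = f p * v h + h p * v f).

Definition derivation_pred (p : M) : {pred Cinf M -> R} :=
  [pred v | `[< derivation_at p v >]].

Lemma derivation_predP p v :
  reflect (derivation_at p v) (v \in derivation_pred p).
Proof. exact: asboolP. Qed.

Lemma derivation_submod_closed p : submod_closed (derivation_pred p).
Proof.
split=> [|a v w /derivation_predP[lv dv] /derivation_predP[lw dw]];
  apply/derivation_predP.
- have E (f : Cinf M) : (0 : Cinf M -> R) f = 0 by [].
  by split=> *; rewrite !E ?mulr0 addr0.
- split=> *; rewrite !fctE /GRing.scale /=; [rewrite lv lw|rewrite dv dw]; ring.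
Qed.

HB.instance Definition _ p :=
  GRing.isSubmodClosed.Build R (Cinf M -> R) (derivation_pred p)
    (derivation_submod_closed p).

Record tangent (p : M) :=
  Tangent { tangent_val :> Cinf M -> R; _ : tangent_val \in derivation_pred p }.

HB.instance Definition _ p := [isSub for @tangent_val p].
HB.instance Definition _ p := [Choice of tangent p by <:].
HB.instance Definition _ p := [SubChoice_isSubZmodule of tangent p by <:].
HB.instance Definition _ p := [SubZmodule_isSubLmodule of tangent p by <:].

Lemma tangentP p (v : tangent p) : derivation_at p v.
Proof. exact/derivation_predP/(valP v). Qed.

(* Testing on globally defined functions suffices, since every germ of a smooth
   function extends to [M]. *)
Definition smooth_section_on (V : set M) (X : forall p, tangent p) : Prop :=
  forall f : Cinf M, smooth_fun_on V (fun p => X p f).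

Record vfield := VField {
  vfield_val :> forall p, tangent p;
  vfield_smooth : smooth_section_on setT vfield_val
}.

End TangentSpaces.

Section VectorFields.
Variables (R : realType) (m : nat) (M : smoothManifold R m).

Lemma vfieldP (X Y : vfield M) : (forall p, X p = Y p) -> X = Y.
Proof.
case: X Y => [X sX] [Y sY] /= XY.
have {}XY : X = Y by exact: functional_extensionality_dep.
by subst Y; congr VField; exact: Prop_irrelevance.
Qed.

HB.instance Definition _ := gen_eqMixin (vfield M).
HB.instance Definition _ := gen_choiceMixin (vfield M).

Definition vact (X : vfield M) (f : Cinf M) : Cinf M := cinf (vfield_smooth X f).

Lemma vf0_smooth : smooth_section_on setT (fun p : M => 0 : tangent p).
Proof. move=> f; exact: smooth_fun_cst. Qed.

Lemma vfD_smooth (X Y : vfield M) :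
  smooth_section_on setT (fun p : M => X p + Y p).
Proof. by move=> f; exact: smooth_funD (vfield_smooth X f) (vfield_smooth Y f). Qed.

Lemma vfZ_smooth (h : Cinf M) (X : vfield M) :
  smooth_section_on setT (fun p : M => h p *: X p).
Proof. by move=> f; exact: smooth_funM (Cinf_smooth h) (vfield_smooth X f). Qed.

Lemma vfN_smooth (X : vfield M) : smooth_section_on setT (fun p : M => - X p).
Proof.
move=> f; have := smooth_funB (smooth_fun_cst 0) (vfield_smooth X f).
by congr smooth_fun_on; apply/funext => p; rewrite sub0r.
Qed.

Definition vf0 : vfield M := VField vf0_smooth.
Definition vfD X Y : vfield M := VField (vfD_smooth X Y).
Definition vfN X : vfield M := VField (vfN_smooth X).
Definition vfZ h X : vfield M := VField (vfZ_smooth h X).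

Lemma vfDA : associative vfD.
Proof. by move=> X Y Z; apply: vfieldP => p /=; rewrite addrA. Qed.
Lemma vfDC : commutative vfD.
Proof. by move=> X Y; apply: vfieldP => p /=; rewrite addrC. Qed.
Lemma vf0D : left_id vf0 vfD.
Proof. by move=> X; apply: vfieldP => p /=; rewrite add0r. Qed.
Lemma vfND : left_inverse vf0 vfN vfD.
Proof. by move=> X; apply: vfieldP => p /=; rewrite addNr. Qed.

HB.instance Definition _ :=
  GRing.isZmodule.Build (vfield M) vfDA vfDC vf0D vfND.

Lemma vfZA a b X : vfZ a (vfZ b X) = vfZ (a * b) X.
Proof. by apply: vfieldP => p /=; rewrite scalerA. Qed.
Lemma vf1Z : left_id 1 vfZ.
Proof. by move=> X; apply: vfieldP => p /=; rewrite scale1r. Qed.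
Lemma vfZDr : right_distributive vfZ +%R.
Proof. by move=> a X Y; apply: vfieldP => p /=; rewrite scalerDr. Qed.
Lemma vfZDl X : {morph vfZ^~ X : a b / a + b}.
Proof. by move=> a b; apply: vfieldP => p /=; rewrite scalerDl. Qed.

HB.instance Definition _ :=
  GRing.Zmodule_isLmodule.Build (Cinf M) (vfield M) vfZA vf1Z vfZDr vfZDl.

Section Bracket.
Variables X Y : vfield M.

Definition bracket_val (p : M) (f : Cinf M) : R :=
  X p (vact Y f) - Y p (vact X f).

Lemma bracket_derivation p : bracket_val p \in derivation_pred p.
Proof.
have actl (Z : vfield M) a (f h : Cinf M) :
    vact Z (a *: f + h) = a *: vact Z f + vact Z h.
  by apply/val_inj/funext => q; rewrite /= (tangentP (Z q)).1.
have actM (Z : vfield M) (f h : Cinf M) :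
    vact Z (f * h) = f * vact Z h + h * vact Z f.
  by apply/val_inj/funext => q; rewrite /= (tangentP (Z q)).2.
have tD (q : M) (v : tangent q) (f h : Cinf M) : v (f + h) = v f + v h.
  by rewrite -[f]scale1r (tangentP v).1 mul1r scale1r.
apply/derivation_predP; split=> *; rewrite /bracket_val.
  by rewrite !actl !(tangentP _).1; ring.
rewrite !actM !tD !(tangentP _).2 /=; ring.
Qed.

Lemma bracket_smooth :
  smooth_section_on setT (fun p : M => Tangent (bracket_derivation p)).
Proof.
move=> f; exact: smooth_funB (vfield_smooth X (vact Y f))
  (vfield_smooth Y (vact X f)).
Qed.

Definition bracket : vfield M := VField bracket_smooth.

End Bracket.

End VectorFields.

Section Riemannian.
Variables (R : realType) (m : nat) (M : smoothManifold R m).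

Record riemannian := Riemannian {
  metric_val :> forall p : M, tangent p -> tangent p -> R;
  metric_linear : forall p a (u v w : tangent p),
    metric_val (a *: u + v) w = a * metric_val u w + metric_val v w;
  metric_sym : forall p (u v : tangent p), metric_val u v = metric_val v u;
  metric_pos : forall p (u : tangent p), u != 0 -> 0 < metric_val u u;
  metric_smooth : forall X Y : vfield M,
    smooth_fun (fun p => metric_val (X p) (Y p))
}.

Definition ip (g : riemannian) (X Y : vfield M) : Cinf M :=
  cinf (metric_smooth g X Y).

Definition affine_connection (N : vfield M -> vfield M -> vfield M) : Prop :=
  [/\ forall (f : Cinf M) X Y Z, N (f *: X + Y) Z = f *: N X Z + N Y Z,
      forall X Y Z, N X (Y + Z) = N X Y + N X Z &
      forall (f : Cinf M) X Y, N X (f *: Y) = f *: N X Y + vact X f *: Y].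

Definition levi_civita (g : riemannian) (N : vfield M -> vfield M -> vfield M) :=
  [/\ affine_connection N,
      forall X Y, N X Y - N Y X = bracket X Y &
      forall X Y Z, vact X (ip g Y Z) = ip g (N X Y) Z + ip g Y (N X Z)].

Definition free_family (n : nat) (p : M) (e : 'I_n -> tangent p) : Prop :=
  forall a : 'I_n -> R, \sum_i a i *: e i = 0 -> forall i, a i = 0.

Definition span_family (n : nat) (p : M) (e : 'I_n -> tangent p) :
    set (tangent p) :=
  [set v | exists a : 'I_n -> R, v = \sum_i a i *: e i].

Record subbundle (n : nat) := Subbundle {
  fibre :> forall p : M, set (tangent p);
  local_frame : forall p : M,
    exists (V : set M) (E : 'I_n -> forall q : M, tangent q),
      [/\ open V, V p, forall i, smooth_section_on V (E i) &
          forall q, V q ->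
            free_family (fun i => E i q) /\ @fibre q = span_family (fun i => E i q)]
}.

Definition is_section (D : forall p : M, set (tangent p)) (X : vfield M) : Prop :=
  forall p, D p (X p).

Definition integrable_distribution (D : forall p : M, set (tangent p)) : Prop :=
  forall X Y, is_section D X -> is_section D Y -> is_section D (bracket X Y).

Definition orthogonal_complement (g : riemannian)
    (D : forall p : M, set (tangent p)) (p : M) : set (tangent p) :=
  [set v | forall w, D p w -> g p v w = 0].
Arguments orthogonal_complement g D p _ : clear implicits.

(* [P] is the map on vector fields induced by the orthogonal projection of the
   tangent bundle onto [D]. This determines [P] uniquely. *)
Definition orthogonal_projection (g : riemannian)
    (D : forall p : M, set (tangent p)) (P : vfield M -> vfield M) : Prop :=
  forall X p, D p (P X p) /\ orthogonal_complement g D p (X p - P X p).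

Definition semi_symmetric (g : riemannian) (N : vfield M -> vfield M -> vfield M)
    (U X Y : vfield M) : vfield M :=
  N X Y + ip g U Y *: X - ip g X Y *: U.

Definition curvature (N : vfield M -> vfield M -> vfield M) (X Y Z : vfield M) :
    vfield M :=
  N X (N Y Z) - N Y (N X Z) - N (bracket X Y) Z.

(* [N] is the connection on the distribution, [piD] and [piN] are the projections
   onto the distribution and onto its orthogonal complement. *)
Definition curvatureD (piD piN : vfield M -> vfield M)
    (N : vfield M -> vfield M -> vfield M) (X Y Z : vfield M) : vfield M :=
  N X (N Y Z) - N Y (N X Z) - N (piD (bracket X Y)) Z
  - piD (bracket (piN (bracket X Y)) Z).

End Riemannian.

(* Main.v *)
Require Import Defs.
From mathcomp Require Import all_boot all_order all_algebra.
From mathcomp Require Import all_classical all_reals all_analysis.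
From mathcomp Require Import ring.

Import Order.TTheory GRing.Theory Num.Theory.
Import numFieldNormedType.Exports.

Local Open Scope classical_set_scope.
Local Open Scope ring_scope.

Set Implicit Arguments.
Unset Strict Implicit.

(** Let T be the semi-symmetric connection, and let N V abbreviate the normal
    part of a field V. Since the two orthogonal projections add up to the
    identity and T is additive in both arguments, each of the three terms of
    the curvature of T splits into a tangential and a normal contribution; the
    tangential ones are those of the curvature of the distribution, up to its
    last bracket term.

    For the second-order terms the normal contribution is g(T_X (N (T_Y Z)), W).
    As T is metric and a normal field is orthogonal to W, this equals
    - g(N (T_Y Z), N (T_X W)) ([semi_symmetric_weingarten]).
    For X in D the normal part of T_X W is B(X, W) - g(X, W) N U
    ([normal_semi_symmetric]), and expanding the product gives four terms, one
    of each kind in the formula; exchanging X and Y gives the other four.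

    For the bracket term, put P = N [X, Y]. What remains is
    g([P, Z] - T_P Z, W), where T may be replaced by nabla because P is
    orthogonal to Z and W. Absence of torsion turns it into
    - g(nabla_Z P, W), which equals g(P, nabla_Z W) = g(B(Z, W), [X, Y])
    ([normal_bracket_term]). *)

(** * Smooth functions paired by the metric *)

Section MetricPairing.
Variables (R : realType) (m : nat) (M : smoothManifold R m) (g : riemannian M).
Implicit Types (X Y Z V : vfield M) (f : Cinf M).

Lemma ipC X Y : ip g X Y = ip g Y X.
Proof. by apply/val_inj/funext => p /=; rewrite Defs.metric_sym. Qed.

Lemma ip_linearl f X Y Z : ip g (f *: X + Y) Z = f * ip g X Z + ip g Y Z.
Proof. by apply/val_inj/funext => p /=; rewrite metric_linear. Qed.

Lemma ipDl X Y Z : ip g (X + Y) Z = ip g X Z + ip g Y Z.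
Proof. by rewrite -[X in X + Y]scale1r ip_linearl mul1r. Qed.

Lemma ip0l Z : ip g 0 Z = 0.
Proof. by apply: (addrI (ip g 0 Z)); rewrite -ipDl !addr0. Qed.

Lemma ipZl f X Z : ip g (f *: X) Z = f * ip g X Z.
Proof. by rewrite -[f *: X]addr0 ip_linearl ip0l addr0. Qed.

Lemma ipNl X Z : ip g (- X) Z = - ip g X Z.
Proof. by rewrite -scaleN1r ipZl mulN1r. Qed.

Lemma ipDr X Y Z : ip g Z (X + Y) = ip g Z X + ip g Z Y.
Proof. by rewrite ipC ipDl !(ipC _ Z). Qed.

Lemma ipZr f X Z : ip g Z (f *: X) = f * ip g Z X.
Proof. by rewrite ipC ipZl (ipC _ Z). Qed.

Lemma ipNr X Z : ip g Z (- X) = - ip g Z X.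
Proof. by rewrite ipC ipNl (ipC _ Z). Qed.

Lemma metric_eq0 p (u : tangent p) : g p u u = 0 -> u = 0.
Proof.
move=> u0; apply/eqP; apply: contraT => /(metric_pos g).
by rewrite u0 ltxx.
Qed.

Lemma ip_nondegenerate X Y : (forall V, ip g X V = ip g Y V) -> X = Y.
Proof.
move=> XY; apply/eqP; rewrite -subr_eq0; apply/eqP/vfieldP => p.
have : ip g (X - Y) (X - Y) = 0 by rewrite ipDl ipNl XY subrr.
move=> /(congr1 (fun f : Cinf M => f p)); exact: metric_eq0.
Qed.

Lemma vact0 X : vact X 0 = 0.
Proof.
apply/val_inj/funext => p /=; have [linX _] := tangentP (X p).
by apply: (addrI (X p 0)); rewrite addr0 -[X in X + _]mul1r -linX scaler0 addr0.
Qed.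

(** For a variable N the summands stay opaque; for a concrete connection,
    bilinearity would also expand the sums hidden in its definition. *)
Lemma ip_curvature (N : vfield M -> vfield M -> vfield M) X Y Z V :
  ip g (curvature N X Y Z) V =
    ip g (N X (N Y Z)) V - ip g (N Y (N X Z)) V - ip g (N (bracket X Y) Z) V.
Proof. by rewrite /curvature !(ipDl, ipNl). Qed.

Lemma ip_curvatureD (piD piN : vfield M -> vfield M)
    (N : vfield M -> vfield M -> vfield M) X Y Z V :
  ip g (curvatureD piD piN N X Y Z) V =
    ip g (N X (N Y Z)) V - ip g (N Y (N X Z)) V
    - ip g (N (piD (bracket X Y)) Z) V
    - ip g (piD (bracket (piN (bracket X Y)) Z)) V.
Proof. by rewrite /curvatureD !(ipDl, ipNl). Qed.

End MetricPairing.

(** * The orthogonal splitting *)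

Section OrthogonalSplitting.
Variables (R : realType) (m : nat) (M : smoothManifold R m) (g : riemannian M).
Variables (D : forall p : M, set (tangent p)) (piD piN : vfield M -> vfield M).
Hypothesis piDP : orthogonal_projection g D piD.
Hypothesis piNP : orthogonal_projection g (orthogonal_complement g D) piN.
Implicit Types V W : vfield M.

Lemma ip_normal_section V W : is_section D W -> ip g (piN V) W = 0.
Proof.
move=> DW; apply/val_inj/funext => p /=.
by have [NV _] := piNP V p; exact: NV.
Qed.

Lemma ip_projection V W : is_section D W -> ip g (piD V) W = ip g V W.
Proof.
move=> DW; apply/esym/eqP; rewrite -subr_eq0 -ipNl -ipDl; apply/eqP.
by apply/val_inj/funext => p /=; have [_ NV] := piDP V p; exact: NV.
Qed.

Lemma ip_normal_normal V W : ip g (piN V) (piN W) = ip g (piN V) W.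
Proof.
apply/esym/eqP; rewrite -subr_eq0 -ipNr -ipDr ipC; apply/eqP.
apply/val_inj/funext => p /=; have [_ NW] := piNP W p.
by apply: NW; have [] := piNP V p.
Qed.

Lemma ip_normalC V W : ip g (piN V) W = ip g V (piN W).
Proof. by rewrite -ip_normal_normal ipC ip_normal_normal ipC. Qed.

(** The defect V - piD V - piN V is orthogonal to D. It is also orthogonal to the
    complement of D, since D lies in its double complement. Hence the defect is
    orthogonal to itself. *)
Lemma projection_split V : V = piD V + piN V.
Proof.
apply/eqP; rewrite -subr_eq0 opprD addrA; apply/eqP/vfieldP => p.
have [DV NV] := piDP V p; have [NV' NNV] := piNP V p.
apply: (metric_eq0 (g := g)).
have orthD (w : tangent p) : D w -> g p (V p - piD V p - piN V p) w = 0.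
  move=> Dw; have := metric_linear g (-1) (piN V p) (V p - piD V p) w.
  by rewrite scaleN1r addrC NV' // NV // mulr0 addr0.
set v := V p - piD V p - piN V p in orthD *.
have vD : g p (piD V p) v = 0 by rewrite Defs.metric_sym orthD.
have vE : v = -1 *: piD V p + (V p - piN V p).
  by rewrite scaleN1r addrC addrAC.
change (g p v v = 0).
by rewrite {1}vE metric_linear vD (NNV v orthD) mulr0 addr0.
Qed.

End OrthogonalSplitting.

(** * The semi-symmetric connection *)

Section SemiSymmetric.
Variables (R : realType) (m : nat) (M : smoothManifold R m) (g : riemannian M).
Variable nabla : vfield M -> vfield M -> vfield M.
Hypothesis nabla_LC : levi_civita g nabla.
Variable U : vfield M.
Implicit Types X Y Z V W : vfield M.

Local Notation tnabla := (semi_symmetric g nabla U).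

Lemma semi_symmetricDl X Y Z : tnabla (X + Y) Z = tnabla X Z + tnabla Y Z.
Proof.
have [[nablaDl _ _] _ _] := nabla_LC; apply: (ip_nondegenerate (g := g)) => V.
have := nablaDl 1 X Y Z; rewrite !scale1r /semi_symmetric => ->.
by rewrite !(ipDl, ipZl, ipNl); ring.
Qed.

Lemma semi_symmetricDr X Y Z : tnabla X (Y + Z) = tnabla X Y + tnabla X Z.
Proof.
have [[_ nablaDr _] _ _] := nabla_LC; apply: (ip_nondegenerate (g := g)) => V.
by rewrite /semi_symmetric nablaDr !(ipDl, ipDr, ipZl, ipNl); ring.
Qed.

(** The correction V |-> omega(V) X - g(X, V) U is skew for g, so T inherits
    metric compatibility from nabla. *)
Lemma semi_symmetric_metric X Y Z :
  vact X (ip g Y Z) = ip g (tnabla X Y) Z + ip g Y (tnabla X Z).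
Proof.
have [_ _ ->] := nabla_LC; rewrite /semi_symmetric.
rewrite !(ipDl, ipDr, ipZl, ipZr, ipNl, ipNr) (ipC _ Y X) (ipC _ Y U).
by ring.
Qed.

Section Distribution.
Variables (D : forall p : M, set (tangent p)) (piD piN : vfield M -> vfield M).
Hypothesis piDP : orthogonal_projection g D piD.
Hypothesis piNP : orthogonal_projection g (orthogonal_complement g D) piN.

Let ip_normalC := ip_normalC piNP.
Let ip_normal_section := ip_normal_section piNP.

(** Weingarten identity: a normal field stays orthogonal to W, so
    differentiating this orthogonality along X moves the derivative from the
    normal field to W. *)
Lemma semi_symmetric_weingarten X V W : is_section D W ->
  ip g (tnabla X (piN V)) W = - ip g (piN V) (piN (tnabla X W)).
Proof.
move=> DW; apply/eqP; rewrite -addr_eq0 (ip_normal_normal piNP).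
by rewrite -semi_symmetric_metric ip_normal_section // vact0.
Qed.

(** The term omega(Z) X of T_X Z is tangential, which leaves only the term along
    U to correct the second fundamental form of nabla. *)
Lemma normal_semi_symmetric X Z : is_section D X ->
  piN (tnabla X Z) = piN (nabla X Z) - ip g X Z *: piN U.
Proof.
move=> DX; apply: (ip_nondegenerate (g := g)) => V.
rewrite ip_normalC !(ipDl, ipZl, ipNl) (ipC _ X (piN V)).
by rewrite ip_normal_section // -!ip_normalC; ring.
Qed.

Lemma ip_normal_semi_symmetric X Y Z W : is_section D X -> is_section D Y ->
  ip g (piN (tnabla Y Z)) (piN (tnabla X W)) =
    ip g (piN (nabla X W)) (piN (nabla Y Z))
    - ip g Y Z * ip g U (piN (nabla X W)) - ip g X W * ip g U (piN (nabla Y Z))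
    + ip g Y Z * ip g X W * ip g U (piN U).
Proof.
move=> DX DY; rewrite !normal_semi_symmetric //.
rewrite !(ipDl, ipDr, ipZl, ipZr, ipNl, ipNr) !(ip_normal_normal piNP).
rewrite !(ip_normalC U) (ip_normalC (nabla X W)).
rewrite !(ipC _ (piN (nabla Y Z))).
by ring.
Qed.

(** Tangential and normal part of T_Y Z are differentiated separately. *)
Lemma ip_second_derivative X Y Z W : is_section D W ->
  ip g (tnabla X (tnabla Y Z)) W =
    ip g (piD (tnabla X (piD (tnabla Y Z)))) W
    - ip g (piN (tnabla Y Z)) (piN (tnabla X W)).
Proof.
move=> DW; rewrite {1}(projection_split piDP piNP (tnabla Y Z)).
rewrite semi_symmetricDr ipDl semi_symmetric_weingarten //.
by rewrite (ip_projection piDP).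
Qed.

(** In T_P Z with P normal, both correction terms are orthogonal to W; without
    torsion, nabla_P Z - [P, Z] is nabla_Z P, and g(nabla_Z P, W) is
    - g(P, nabla_Z W) because P is orthogonal to W. *)
Lemma normal_bracket_term V Z W : is_section D Z -> is_section D W ->
  ip g (bracket (piN V) Z) W - ip g (tnabla (piN V) Z) W =
    ip g (piN (nabla Z W)) V.
Proof.
move=> DZ DW; have [_ torsion_free metric] := nabla_LC.
rewrite -torsion_free /semi_symmetric !(ipDl, ipZl, ipNl).
have -> : ip g (nabla Z (piN V)) W = - ip g (piN V) (nabla Z W).
  by apply/eqP; rewrite -addr_eq0 -metric ip_normal_section // vact0.
rewrite (ip_normal_section _ DZ) (ip_normal_section _ DW).
by rewrite ip_normalC (ipC _ V); ring.
Qed.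

End Distribution.
End SemiSymmetric.

(** * The curvature equation *)

Unset Implicit Arguments.
Set Strict Implicit.

Theorem theorem2p4 (R : realType) (m n : nat) (M : smoothManifold R m)
    (g : riemannian M)
    (nabla : vfield M -> vfield M -> vfield M)
    (nabla_LC : levi_civita g nabla)
    (D : subbundle M n)
    (D_nonintegrable : ~ integrable_distribution D)
    (piD piDperp : vfield M -> vfield M)
    (piDP : orthogonal_projection g D piD)
    (piDperpP : orthogonal_projection g (orthogonal_complement g D) piDperp)
    (U : vfield M) :
  let B := fun X Y : vfield M => piDperp (nabla X Y) in
  let omega := fun V : vfield M => ip g U V in
  let tnabla := semi_symmetric g nabla U in
  let tnablaD := fun X Y : vfield M => piD (tnabla X Y) in
  let tR := fun X Y Z W : vfield M => ip g (curvature tnabla X Y Z) W in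
  let tRD := fun X Y Z W : vfield M =>
    ip g (curvatureD piD piDperp tnablaD X Y Z) W in
  forall X Y Z W : vfield M,
    is_section D X -> is_section D Y -> is_section D Z -> is_section D W ->
    tR X Y Z W =
      tRD X Y Z W - ip g (B X W) (B Y Z) + ip g (B Y W) (B X Z)
      + ip g Y Z * omega (B X W) - ip g X Z * omega (B Y W)
      + ip g X W * omega (B Y Z)
      - ip g Y W * omega (B X Z) - ip g Y Z * ip g X W * omega (piDperp U)
      + ip g X Z * ip g Y W * omega (piDperp U) + ip g (B Z W) (bracket X Y).
Proof.
move=> B omega tnabla tnablaD tR tRD X Y Z W DX DY DZ DW.
pose P := piDperp (bracket X Y).
have bracket_split : ip g (tnabla (bracket X Y) Z) W =
    ip g (tnablaD (piD (bracket X Y)) Z) W + ip g (tnabla P Z) W.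
  rewrite (ip_projection piDP) // -ipDl -(semi_symmetricDl nabla_LC).
  by rewrite -(projection_split piDP piDperpP).
have XY := ip_second_derivative nabla_LC U piDP piDperpP X Y Z DW.
have YX := ip_second_derivative nabla_LC U piDP piDperpP Y X Z DW.
rewrite (ip_normal_semi_symmetric nabla U piDperpP) // in XY.
rewrite (ip_normal_semi_symmetric nabla U piDperpP) // in YX.
have torsion := normal_bracket_term nabla_LC U piDperpP (bracket X Y) DZ DW.
rewrite /tR /tRD ip_curvature ip_curvatureD.
rewrite bracket_split XY YX (ip_projection piDP (bracket P Z)) //.
rewrite /B /omega -torsion /P /tnablaD /tnabla.
by ring.
Qed.
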